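(* Let $n\ge 3$ and $X\in\{LD,LTD\}$. Then $\gamma_X(K_{1,n})=n$ and $\gamma_X(M(K_{1,n}))=2n$.
   Context: For a graph $G=(V,E)$ and $x\in V$, $N(x)$ is the open neighbourhood and $N[x]=N(x)\cup\{x\}$. A set $C\subseteq V$ is a locating-dominating set ($LD$-set) if $N[x]\cap C\ne\emptyset$ for all $x\in V$ and $N(x)\cap C\ne N(y)\cap C$ for all distinct $x,y\in V\setminus C$; it is a locating total-dominating set ($LTD$-set) if $N(x)\cap C\ne\emptyset$ for all $x\in V$ and $N(x)\cap C\ne N(y)\cap C$ for all distinct $x,y\in V\setminus C$. $\gamma_X(G)$ is the minimum size of an $X$-set of $G$. $K_{1,n}$ is the star with one centre and $n$ leaves. The Mycielski graph $M(G)$ of $G$ with $V=\{v_1,\dots,v_m\}$ is obtained from $G$ by adding, for each $i$, a new vertex $u_i$ adjacent to every vertex of $N_G(v_i)$, and then adding one further vertex $u$ adjacent to all of $u_1,\dots,u_m$ (and to nothing else). *)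

(* Defs.v *)
From mathcomp Require Import all_boot all_order.

Set Implicit Arguments.
Unset Strict Implicit.
Unset Printing Implicit Defensive.

Record sgraph := SGraph {
  vertex :> finType;
  adj : rel vertex;
  adj_sym : symmetric adj;
  adj_irr : irreflexive adj
}.

Definition open_nbhd (G : sgraph) (x : G) : {set G} := [set y | adj x y].
Definition closed_nbhd (G : sgraph) (x : G) : {set G} := x |: open_nbhd x.

Definition dominating (G : sgraph) (C : {set G}) : bool :=
  [forall x : G, closed_nbhd x :&: C != set0].

Definition total_dominating (G : sgraph) (C : {set G}) : bool :=
  [forall x : G, open_nbhd x :&: C != set0].

Definition locating (G : sgraph) (C : {set G}) : bool :=
  [forall x : G, forall y : G,
    [&& x \notin C, y \notin C & x != y] ==>
      (open_nbhd x :&: C != open_nbhd y :&: C)].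

Variant code_type := LD | LTD.

Definition is_code (X : code_type) (G : sgraph) (C : {set G}) : bool :=
  match X with
  | LD => dominating C && locating C
  | LTD => total_dominating C && locating C
  end.

(* If G has no X-set (possible for LTD when G has an isolated vertex), the
   value is #|G|.+1, which is not the size of any vertex set: see gammaP. *)
Definition gamma (X : code_type) (G : sgraph) : nat :=
  \big[minn/#|G|.+1]_(C : {set G} | is_code X C) #|C|.

Lemma gammaP (X : code_type) (G : sgraph) (k : nat) : k <= #|G| ->
  gamma X G = k <->
  (exists2 C : {set G}, is_code X C & #|C| = k) /\
  (forall C : {set G}, is_code X C -> k <= #|C|).
Proof.
move=> kG.
have gle (C : {set G}) : is_code X C -> gamma X G <= #|C|.
  rewrite /gamma => XC; have := mem_index_enum C.
  elim: (index_enum _) => // D s IHs; rewrite inE big_cons => /predU1P[<-|Cs].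
    by rewrite XC geq_minl.
  by case: ifP => _; [apply: leq_trans (geq_minr _ _) _|]; exact: IHs.
have gex : gamma X G = #|G|.+1 \/
    exists2 C : {set G}, is_code X C & #|C| = gamma X G.
  rewrite /gamma; elim/big_ind: _; first by left.
    by move=> x y Hx Hy; rewrite /minn; case: ifP.
  by move=> C XC; right; exists C.
split=> [gk | [[C XC Ck] kle]].
  split; last by move=> C /gle; rewrite gk.
  by case: gex => [g|]; [move: kG; rewrite -gk g ltnn | rewrite gk].
apply/eqP; rewrite eqn_leq -{1}Ck gle //=.
case: gex => [->|[D XD <-]]; [exact: leqW | exact: kle].
Qed.

(* None is the centre, Some i the i-th leaf. *)
Definition star_adj (n : nat) : rel (option 'I_n) :=
  fun x y => (x == None) != (y == None).

Lemma star_adj_sym n : symmetric (@star_adj n).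
Proof. by move=> x y; rewrite /star_adj eq_sym. Qed.

Lemma star_adj_irr n : irreflexive (@star_adj n).
Proof. by move=> x; rewrite /star_adj eqxx. Qed.

Definition star (n : nat) : sgraph :=
  SGraph (@star_adj_sym n) (@star_adj_irr n).

(* Some (inl v_i) is v_i, Some (inr v_i) is u_i, and None is u. *)
Definition mycielski_adj (G : sgraph) : rel (option (G + G)) :=
  fun a b =>
    match a, b with
    | Some (inl x), Some (inl y)
    | Some (inl x), Some (inr y)
    | Some (inr x), Some (inl y) => adj x y
    | Some (inr _), None | None, Some (inr _) => true
    | _, _ => false
    end.

Lemma mycielski_adj_sym (G : sgraph) : symmetric (@mycielski_adj G).
Proof. by move=> [[x|x]|] [[y|y]|] //=; rewrite adj_sym. Qed.

Lemma mycielski_adj_irr (G : sgraph) : irreflexive (@mycielski_adj G).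
Proof. by move=> [[x|x]|] //=; rewrite adj_irr. Qed.

Definition mycielski (G : sgraph) : sgraph :=
  SGraph (@mycielski_adj_sym G) (@mycielski_adj_irr G).

(* Main.v *)
Require Import Defs.
From mathcomp Require Import all_boot all_order.
From mathcomp Require Import zify.

(** Leaves of the star are pairwise twins, so a locating set misses at most one
    of them; if it misses one, domination of that leaf forces the centre in.
    In the Mycielski graph the leaves [l_i] and their copies [l'_i] form two
    such families, with neighbourhoods [{c, c'}] and [{c, u}]; if one vertex of
    each family is missed, these two neighbourhoods must have distinct nonempty
    traces, which takes two of [c], [c'], [u].  The lower bounds are met by all
    leaves but one together with [c], respectively by all [l_i] and [l'_i] with
    [i <> 0] together with [c] and [c']. *)

Lemma is_code_LD (X : code_type) (G : sgraph) (C : {set G}) :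
  is_code X C -> is_code LD C.
Proof.
case: X => //= /andP[/forallP totC ->]; rewrite andbT; apply/forallP => x.
have /set0Pn[y /setIP[xy yC]] := totC x.
by apply/set0Pn; exists y; rewrite in_setI yC andbT in_setU1 xy orbT.
Qed.

Lemma is_code_LTD (X : code_type) (G : sgraph) (C : {set G}) :
  is_code LTD C -> is_code X C.
Proof. by move=> codeC; case: X => //; apply: is_code_LD codeC. Qed.

(** Every [LTD]-set is an [LD]-set, so a witness for the stronger notion and a lower bound for the
    weaker one settle both values of [X] at once. *)
Lemma gamma_eq (X : code_type) (G : sgraph) (k : nat) :
  (exists2 C : {set G}, is_code LTD C & #|C| = k) ->
  (forall C : {set G}, is_code LD C -> k <= #|C|) -> gamma X G = k.
Proof.
move=> [C codeC cardC] lowC; apply/gammaP; first by rewrite -cardC max_card.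
split; first by exists C => //; apply: is_code_LTD.
by move=> D /is_code_LD /lowC.
Qed.

Lemma total_dominating_intro (G : sgraph) (C : {set G}) :
  (forall x, exists2 y, adj x y & y \in C) -> total_dominating C.
Proof.
move=> domC; apply/forallP => x; have [y xy yC] := domC x.
by apply/set0Pn; exists y; rewrite !inE xy.
Qed.

Lemma locating_intro (G : sgraph) (C : {set G}) :
  (forall x y, x \notin C -> y \notin C -> x != y ->
     exists2 z, z \in C & adj x z != adj y z) -> locating C.
Proof.
move=> sepC; apply/forallP => x; apply/forallP => y.
apply/implyP => /and3P[xC yC /(sepC _ _ xC yC)[z zC]].
by apply: contraNneq => /setP/(_ z); rewrite !inE zC !andbT => ->.
Qed.

Lemma LD_dominated (G : sgraph) (C : {set G}) (x : G) :
  is_code LD C -> x \notin C -> exists2 y, adj x y & y \in C.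
Proof.
case/andP=> /forallP/(_ x)/set0Pn[y /setIP[xy yC]] _ xC.
exists y => //; move: xy; rewrite !inE => /predU1P[eyx|//].
by rewrite eyx (negPf xC) in yC.
Qed.

Lemma locating_eq (G : sgraph) (C : {set G}) (x y : G) :
  locating C -> x \notin C -> y \notin C ->
  {in C, adj x =1 adj y} -> x = y.
Proof.
move=> /forallP/(_ x)/forallP/(_ y)/implyP locC xC yC eqN.
apply/eqP/negPn/negP => xy; move: locC.
rewrite xC yC xy => /(_ isT)/eqP[]; apply/setP.
move=> z; rewrite !inE; case zC: (z \in C); rewrite ?andbF ?andbT //.
exact: eqN.
Qed.

Lemma sum_neq1 n (i0 : 'I_n) : \sum_(i < n) (i != i0) = n.-1.
Proof.
have := cardC1 i0; rewrite card_ord => <-.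
by rewrite -sum1_card [RHS]big_mkcond; apply: eq_bigr => i _; rewrite inE; case: eqP.
Qed.

(** Two missed twins would have the same trace on [C]. Counting by sums of booleans matches the
    cardinality formulas below, so that every lower bound becomes linear arithmetic. *)
Lemma sum_twins n (G : sgraph) (C : {set G}) (f : 'I_n -> G) :
  locating C -> injective f -> (forall i j, adj (f i) =1 adj (f j)) ->
  (\sum_(i < n) (f i \in C) = n) \/
  (exists2 i, f i \notin C & \sum_(i < n) (f i \in C) = n.-1).
Proof.
move=> locC injf twins.
case: (pickP (fun i => f i \notin C)) => [i0 i0C|inC]; [right|left].
  exists i0 => //; rewrite -(sum_neq1 n i0); apply: eq_bigr => i _; congr nat_of_bool.
  case: eqVneq => [->|/eqP ii0]; first exact: negbTE.
  apply/negPn/negP => iC; apply: ii0.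
  by apply: injf; apply: (locating_eq _ C) => // z _; apply: twins.
rewrite -[RHS]card_ord -sum1_card.
by apply: eq_bigr => i _; move/negbFE: (inC i) => ->.
Qed.

Lemma sum_option (T : finType) (F : option T -> nat) :
  \sum_x F x = F None + \sum_x F (Some x).
Proof.
rewrite (bigD1 None) //=; congr addn.
rewrite (reindex_omap Some id) => [|[]//].
by apply: eq_bigl => x /=; rewrite eqxx.
Qed.

Lemma card_sum (T : finType) (C : {set T}) : #|C| = \sum_x (x \in C).
Proof. by rewrite -sum1_card big_mkcond; apply: eq_bigr => x _; case: ifP. Qed.

Lemma card_star n (C : {set star n}) :
  #|C| = (None \in C) + \sum_(i < n) (Some i \in C).
Proof. by rewrite card_sum sum_option. Qed.

Lemma card_mycielski_star n (C : {set mycielski (star n)}) :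
  #|C| = (None \in C) +
    ((Some (inl None) \in C) + \sum_(i < n) (Some (inl (Some i)) \in C) +
     ((Some (inr None) \in C) + \sum_(i < n) (Some (inr (Some i)) \in C))).
Proof. by rewrite card_sum sum_option big_sumType /= !sum_option. Qed.

Lemma gamma_star (n : nat) (X : code_type) : 1 < n -> gamma X (star n) = n.
Proof.
case: n => [|[|n]] // _; apply: gamma_eq => [|C codeC].
  pose C : {set star n.+2} := [set x : option 'I_n.+2 | x != Some ord0].
  exists C; last first.
    rewrite card_star inE; under eq_bigr do rewrite inE.
    by rewrite (sum_neq1 _ ord0).
  apply/andP; split.
    apply: total_dominating_intro => -[i|]; first by exists None; rewrite ?inE.
    (* With at least two leaves, [ord_max] differs from the omitted [ord0]. *)
    by exists (Some ord_max); rewrite ?inE.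
  (* Only one vertex lies outside [C], so there is no pair to separate. *)
  by apply: locating_intro => x y; rewrite !inE !negbK => /eqP-> /eqP->; rewrite eqxx.
have /andP[_ locC] := codeC; rewrite card_star.
have [|//|->|[i iC ->]] := sum_twins n.+2 (star n.+2) C Some locC.
- by move=> i j [].
- lia.
(* The only neighbour of the missed leaf is the centre, which makes up for it in the count. *)
have [[j|] //= _ ->] := LD_dominated _ _ _ codeC iC; lia.
Qed.

Lemma gamma_mycielski_star (n : nat) (X : code_type) :
  1 < n -> gamma X (mycielski (star n)) = 2 * n.
Proof.
case: n => [|[|n]] // _; apply: gamma_eq => [|C codeC].
  pose P (x : option (option 'I_n.+2 + option 'I_n.+2)) :=
    match x with
    | None => false
    | Some (inl y) | Some (inr y) => y != Some ord0
    end.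
  pose C : {set mycielski (star n.+2)} := [set x | P x].
  exists C; last first.
    rewrite card_mycielski_star !inE /=.
    under eq_bigr do rewrite inE; under [in X in _ + (_ + X)]eq_bigr do rewrite inE.
    by rewrite /= (sum_neq1 _ ord0); lia.
  have outC (x : mycielski (star n.+2)) : x \notin C ->
      [\/ x = None, x = Some (inl (Some ord0)) | x = Some (inr (Some ord0))].
    case: x => [[x|x]|]; rewrite inE /= ?negbK.
    - by move/eqP->; apply: Or32.
    - by move/eqP->; apply: Or33.
    - by move=> _; apply: Or31.
  apply/andP; split.
    apply: total_dominating_intro => -[[[i|]|[i|]]|].
    - by exists (Some (inl None)); rewrite ?inE.
    - by exists (Some (inl (Some ord_max))); rewrite ?inE.
    - by exists (Some (inl None)); rewrite ?inE.
    - by exists (Some (inl (Some ord_max))); rewrite ?inE.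
    - by exists (Some (inr None)); rewrite ?inE.
  apply: locating_intro => x y /outC Ox /outC Oy.
  (* The vertex [c] is adjacent to both omitted leaves but not to [u]; the vertex [c'] is adjacent
     to the omitted [l_0] but not to [l'_0]. *)
  case: Ox => ->; case: Oy => ->; rewrite ?eqxx // => _.
  - by exists (Some (inl None)); rewrite ?inE.
  - by exists (Some (inl None)); rewrite ?inE.
  - by exists (Some (inl None)); rewrite ?inE.
  - by exists (Some (inr None)); rewrite ?inE.
  - by exists (Some (inl None)); rewrite ?inE.
  - by exists (Some (inr None)); rewrite ?inE.
have /andP[_ locC] := codeC; rewrite card_mycielski_star.
pose l i : mycielski (star n.+2) := Some (inl (Some i)).
pose l' i : mycielski (star n.+2) := Some (inr (Some i)).
have injl : injective l by move=> i j [].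
have injl' : injective l' by move=> i j [].
have domL i : l i \notin C ->
    (Some (inl None) \in C) || (Some (inr None) \in C).
  by case/(LD_dominated _ _ _ codeC) => [[[[j|]|[j|]]|]] //= _ ->; rewrite ?orbT.
have domL' i : l' i \notin C -> (Some (inl None) \in C) || (None \in C).
  by case/(LD_dominated _ _ _ codeC) => [[[[j|]|[j|]]|]] //= _ ->; rewrite ?orbT.
(* If at most one family misses a vertex, the one dominator forced into [C] compensates for it. *)
have [//|->|[i iC ->]] := sum_twins _ _ C l locC injl;
  have [//|->|[j jC ->]] := sum_twins _ _ C l' locC injl'.
- lia.
- by have := domL' j jC; lia.
- by have := domL i iC; lia.
have := domL i iC; have := domL' j jC.
(* Both families miss a vertex, so two of [c], [c'], [u] are needed. Domination yields two unless
   [c] is the only one in [C]. *)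
case cC: (Some (inl None) \in C); case c'C: (Some (inr None) \in C);
  case uC: (None \in C) => //= _ _; try lia.
(* Here both missed vertices have trace [{c}], so location would identify an original leaf with a
   copy. *)
have // : l i = l' j.
apply: (locating_eq _ C) => // -[[[k|]|[k|]]|] //= zC.
  by rewrite c'C in zC.
by rewrite uC in zC.
Qed.

Theorem theorem4 (n : nat) (X : code_type) : 3 <= n ->
  gamma X (star n) = n /\ gamma X (mycielski (star n)) = 2 * n.
Proof.
by move=> /ltnW n2; split; [apply: gamma_star | apply: gamma_mycielski_star].
Qed.
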